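(* For arbitrary $y\in\mathbb{R}$, distinct non-zero $a_1,a_2,\dots,a_n\in\mathbb{R}$ and an integer $n\ge 0$, $$\frac{y^n}{a_1a_2\cdots a_n}-\sum_{i=1}^n\frac{(y+a_i)^n}{a_i(a_1-a_i)(a_2-a_i)\cdots\widehat{(a_i-a_i)}\cdots(a_n-a_i)}=(-1)^n ,$$ or equivalently, $$\sum_{i=1}^n\frac{a_i^k}{(a_1-a_i)(a_2-a_i)\cdots\widehat{(a_i-a_i)}\cdots(a_n-a_i)}=\begin{cases}\dfrac{1}{a_1a_2\cdots a_n}, & \text{if } k=-1,\\ 0, & \text{if } k=0,1,\dots,n-2,\\ (-1)^{n-1}, & \text{if } k=n-1.\end{cases}$$
   Context: The hat $\widehat{\ \ }$ over a factor means that the factor is omitted from the product. Convention: $0^0=1$.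
   Formalization: The second identity is stated only for n ≥ 1: for n = 0 it is false, since at k = -1 the empty sum 0 would have to equal 1 (and the cases k = -1 and k = n-1 would coincide with different values). The first identity is stated for all n ≥ 0. *)

(* Defs.v *)
From mathcomp Require Import all_boot all_order all_algebra.
From mathcomp Require Import reals.

Set Implicit Arguments.
Unset Strict Implicit.
Unset Printing Implicit Defensive.

(* Main.v *)
Require Import Defs.
From mathcomp Require Import all_boot all_order all_algebra.
From mathcomp Require Import reals.

Import Order.TTheory GRing.Theory Num.Theory.
Local Open Scope ring_scope.

(** The sums of a_i^k over the products of the a_j - a_i are what one gets by
    interpolating a monomial at the nodes a_i.  With L_i the product of the
    a_j - X over j <> i, a polynomial p of degree less than n equals the sum
    of (p(a_i) / L_i(a_i)) L_i, and L_i(a_i) is the denominator in question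
    ([lagrange_interpolation]).  Two linear functionals of this identity give
    all the cases of the power sums:
    - the coefficient of X^(n-1), which is (-1)^(n-1) in every L_i, applied to
      p = X^k with k < n, gives 0 for k < n - 1 and (-1)^(n-1) for k = n - 1
      ([sum_horner_div_node_prod], [sum_exp_div_node_prod]);
    - the value at 0, where L_i takes the value (a_1 ... a_n) / a_i, applied to
      p = 1, gives the case k = -1 ([sum_inv_div_node_prod]).

    The identity in y follows by expanding (y + a_i)^n / a_i with the binomial
    formula: it is a combination of the powers a_i^k for k = -1, ..., n - 1, of
    which only k = -1 (with coefficient y^n) and k = n - 1 (with coefficient 1)
    survive the summation over i. *)

(** The interpolation basis, with factors a_j - X rather than X - a_j, so that
    no sign appears in its values at the nodes nor at 0. *)
Definition node_poly {F : fieldType} {n : nat} (a : 'I_n -> F) (i : 'I_n) :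
  {poly F} := \prod_(j < n | j != i) ((a j)%:P - 'X).

Lemma horner_node_poly {F : fieldType} {n : nat} (a : 'I_n -> F) i x :
  (node_poly a i).[x] = \prod_(j < n | j != i) (a j - x).
Proof. by rewrite horner_prod; apply: eq_bigr => j _; rewrite !hornerE. Qed.

Lemma node_polyE {F : fieldType} {n : nat} (a : 'I_n.+1 -> F) i :
  node_poly a i
  = (-1) ^+ n *: \prod_(j < n.+1 | j != i) ('X - (a j)%:P).
Proof.
rewrite /node_poly (eq_bigr (fun j => - ('X - (a j)%:P))); last first.
  by move=> j _; rewrite opprB.
by rewrite prodrN cardC1 card_ord /= -mul_polyC rmorph_sign.
Qed.

Lemma size_prod_XsubC_neq {F : fieldType} {n : nat} (a : 'I_n.+1 -> F) i :
  size (\prod_(j < n.+1 | j != i) ('X - (a j)%:P)) = n.+1.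
Proof.
rewrite -big_filter size_prod_XsubC size_filter -sum1_count sum1_card.
by rewrite cardC1 card_ord.
Qed.

Lemma size_node_poly {F : fieldType} {n : nat} (a : 'I_n.+1 -> F) i :
  size (node_poly a i) = n.+1.
Proof. by rewrite node_polyE size_scale ?signr_eq0 // size_prod_XsubC_neq. Qed.

Lemma coef_node_poly {F : fieldType} {n : nat} (a : 'I_n.+1 -> F) i :
  (node_poly a i)`_n = (-1) ^+ n.
Proof.
have := lead_coef_prod_XsubC (index_enum 'I_n.+1) (fun j => j != i) a.
by rewrite node_polyE coefZ lead_coefE size_prod_XsubC_neq => ->; rewrite mulr1.
Qed.

(** The difference of the two sides has degree less than [n] and vanishes at
    the [n] distinct nodes. *)
Lemma lagrange_interpolation {F : fieldType} {n : nat} (a : 'I_n -> F)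
    (a_inj : injective a) (p : {poly F}) :
  (size p <= n)%N ->
  p = \sum_(i < n) (p.[a i] / \prod_(j < n | j != i) (a j - a i))
                   *: node_poly a i.
Proof.
case: n a a_inj => [|n] a a_inj sp.
  by rewrite big_ord0; apply/eqP; rewrite -size_poly_leq0.
apply/eqP; rewrite -subr_eq0; set q := (X in X == 0); apply/eqP.
apply: (@roots_geq_poly_eq0 _ _ (codom a)); last first.
- rewrite size_codom card_ord (leq_trans (size_polyD _ _)) // geq_max sp /=.
  rewrite size_polyN (leq_trans (size_sum _ _ _)) //; apply/bigmax_leqP => i _.
  by rewrite (leq_trans (size_scale_leq _ _)) // size_node_poly.
- by rewrite codomE map_inj_uniq // enum_uniq.
apply/allP => _ /codomP[i ->]; rewrite /root /q hornerD hornerN horner_sum.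
rewrite (bigD1 i) //= [X in _ - (_ + X)]big1 => [|k ki].
  rewrite hornerZ horner_node_poly addr0 divfK ?subrr //.
  by apply/prodf_neq0 => j ji; rewrite subr_eq0 inj_eq.
rewrite hornerZ horner_node_poly [\prod_(j < n.+1 | _) (a j - a i)](bigD1 i) /=; last first.
  by rewrite eq_sym.
by rewrite subrr mul0r mulr0.
Qed.

Lemma sum_horner_div_node_prod {F : fieldType} {n : nat} (a : 'I_n.+1 -> F)
    (a_inj : injective a) (p : {poly F}) :
  (size p <= n.+1)%N ->
  \sum_(i < n.+1) p.[a i] / \prod_(j < n.+1 | j != i) (a j - a i)
  = (-1) ^+ n * p`_n.
Proof.
move=> /(lagrange_interpolation a a_inj p) eq_p.
rewrite [in RHS]eq_p coef_sum mulr_sumr.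
apply: eq_bigr => i _.
by rewrite coefZ coef_node_poly mulrCA -expr2 sqrr_sign mulr1.
Qed.

Lemma sum_exp_div_node_prod {F : fieldType} {n : nat} (a : 'I_n.+1 -> F)
    (a_inj : injective a) (k : nat) :
  (k <= n)%N ->
  \sum_(i < n.+1) a i ^+ k / \prod_(j < n.+1 | j != i) (a j - a i)
  = if k == n then (-1) ^+ n else 0.
Proof.
move=> kn; have := sum_horner_div_node_prod a a_inj 'X^k.
rewrite size_polyXn ltnS kn coefXn eq_sym mulr_natr mulrb => /(_ isT) <-.
by apply: eq_bigr => i _; rewrite hornerXn.
Qed.

Lemma sum_inv_div_node_prod {F : fieldType} {n : nat} (a : 'I_n.+1 -> F)
    (a_neq0 : forall i, a i != 0) (a_inj : injective a) :
  \sum_(i < n.+1) (a i)^-1 / \prod_(j < n.+1 | j != i) (a j - a i)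
  = (\prod_(i < n.+1) a i)^-1.
Proof.
have prod_neq0 : \prod_(i < n.+1) a i != 0 by apply/prodf_neq0.
have := lagrange_interpolation a a_inj 1.
rewrite size_poly1 => /(_ isT) /(congr1 (fun p => p.[0])).
rewrite hornerC horner_sum => eq1.
apply: (mulIf prod_neq0); rewrite mulVf // [RHS]eq1 mulr_suml.
apply: eq_bigr => i _; rewrite hornerZ hornerC horner_node_poly mul1r.
rewrite [X in _ = _ * X](eq_bigr a) => [|j _]; last by rewrite subr0.
rewrite [\prod_(j < n.+1) a j](bigD1 i) //=.
by rewrite mulrAC mulrA mulVf // mul1r mulrC.
Qed.

Lemma exprDn_div {F : fieldType} (n : nat) (y x : F) :
  x != 0 ->
  (y + x) ^+ n.+1 / x
  = y ^+ n.+1 / x + \sum_(k < n.+1) (y ^+ (n - k) *+ 'C(n.+1, k.+1)) * x ^+ k.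
Proof.
move=> x_neq0; rewrite exprDn big_ord_recl subn0 bin0 mulr1n expr0 mulr1 mulrDl.
congr (_ + _); rewrite mulr_suml; apply: eq_bigr => k _.
by rewrite /= /bump /= add1n subSS exprSr -mulrnAl mulrA mulrnAl mulfK.
Qed.

Theorem theorem1p4 (R : realType) (n : nat) (a : 'I_n -> R)
    (a_neq0 : forall i : 'I_n, a i != 0) (a_inj : injective a) :
  (forall y : R,
     y ^+ n / (\prod_(i < n) a i)
     - \sum_(i < n) (y + a i) ^+ n
                    / (a i * \prod_(j < n | j != i) (a j - a i))
     = (-1) ^+ n)
  /\
  ((0 < n)%N ->
   forall k : int,
     let S := \sum_(i < n) a i ^ k / \prod_(j < n | j != i) (a j - a i) in
     [/\ k = -1 -> S = 1 / (\prod_(i < n) a i),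
         0 <= k <= n%:Z - 2 -> S = 0
       & k = n%:Z - 1 -> S = (-1) ^+ n.-1]).
Proof.
case: n a a_neq0 a_inj => [|n] a a_neq0 a_inj.
  by split=> // y; rewrite !big_ord0 subr0 !expr0 divr1.
split=> [y|_ k S].
- under [X in _ - X]eq_bigr => i _.
    rewrite invfM mulrA exprDn_div // mulrDl -mulrA mulr_suml.
    under [X in _ + X]eq_bigr => k _ do rewrite -mulrA.
    over.
  rewrite big_split /= -mulr_sumr sum_inv_div_node_prod // opprD addrA subrr.
  rewrite add0r exchange_big /=.
  under eq_bigr => k _.
    rewrite -mulr_sumr sum_exp_div_node_prod -1?ltnS //.
    over.
  rewrite big_ord_recr /= big1 => [|k _]; last by rewrite ltn_eqF ?mulr0.
  by rewrite eqxx subnn binn expr0 mulr1n mul1r add0r exprS mulN1r.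
- split.
  + by move=> k1; rewrite div1r -sum_inv_div_node_prod // /S k1.
  + case: k @S => [k|//] S /andP[_ le_k].
    have lt_kn : (k < n)%N.
      by move: le_k; rewrite lerBrDr -[2]/(2%:Z) -PoszD lez_nat addn2 ltnS.
    by rewrite /S sum_exp_div_node_prod ?(ltnW lt_kn) // ltn_eqF.
  + have -> : n.+1%:Z - 1 = n by rewrite intS addrC addKr.
    by move=> kn; rewrite /S kn sum_exp_div_node_prod // eqxx.
Qed.
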